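(* Let $G=K_{s}^{t}$ with $2\le t\le s$, $s+t=n$, and let $\tilde{G}=K^{n_{1},\ldots,n_{k}}_{n}$ with $k\ge2$, $n_i\ge1$, $\sum_{i=1}^k n_i+1=n$. Then $G$ and $\tilde{G}$ are not $D$-cospectral.
   Context: Two connected graphs are $D$-cospectral if their distance matrices have the same spectrum. $K_{s}^{t}$ denotes the graph on $s+t$ vertices obtained from the complete graph $K_s$ by attaching a pendant edge (a new vertex of degree 1) to each of $t$ distinct vertices of $K_s$. $K^{n_{1},\ldots,n_{k}}_{n}$ denotes the graph on $n$ vertices having a vertex $v$ of degree $n-1$ such that $G-v$ is the disjoint union of complete graphs $K_{n_1},\dots,K_{n_k}$. *)

(* Defs.v *)
From mathcomp Require Import all_boot all_order all_algebra.
Set Implicit Arguments. Unset Strict Implicit. Unset Printing Implicit Defensive.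
Import GRing.Theory.

Fixpoint walkn (n : nat) (e : rel 'I_n) (k : nat) (x y : 'I_n) : bool :=
  if k is k'.+1 then [exists z, e x z && walkn e k' z y] else x == y.

(* Graph distance: least k with a walk of length k from x to y
   (for a connected graph on n vertices such k < n always exists). *)
Definition gdist (n : nat) (e : rel 'I_n) (x y : 'I_n) : nat :=
  find (fun k => walkn e k x y) (iota 0 n).

Definition distmx (n : nat) (e : rel 'I_n) : 'M[int]_n :=
  \matrix_(i, j) Posz (gdist e i j).

(* D-cospectral: distance matrices have the same spectrum (with
   multiplicities), i.e. the same characteristic polynomial. *)
Definition D_cospectral (m n : nat) (e1 : rel 'I_m) (e2 : rel 'I_n) : Prop :=
  char_poly (distmx e1) = char_poly (distmx e2).

(* K_s^t on vertices 0..s+t-1: vertices 0..s-1 form K_s, vertex s+j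
   (j < t) is a pendant vertex attached to vertex j. *)
Definition Kst_adj (s t : nat) : rel 'I_(s + t) :=
  fun i j => (i != j) &&
    [|| (i < s) && (j < s),
        (s <= i) && (j == i - s :> nat)
      | (s <= j) && (i == j - s :> nat)].

(* K_n^{n_1,...,n_k} with ns = [:: n_1; ...; n_k], on vertices
   0..sumn ns: vertex 0 is the dominating vertex v, and vertices
   1..sumn ns are split into consecutive blocks of sizes n_1,...,n_k,
   each block inducing a clique. *)
Definition block (ns : seq nat) (v : nat) : nat :=
  find (fun b => v <= sumn (take b.+1 ns)) (iota 0 (size ns)).

Definition Kns_adj (ns : seq nat) : rel 'I_(sumn ns).+1 :=
  fun i j => (i != j) &&
    [|| i == 0 :> nat, j == 0 :> nat | block ns i == block ns j].

Arguments Kst_adj : clear implicits.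
Arguments Kns_adj : clear implicits.

(* Main.v *)
Require Import Defs.
From mathcomp Require Import all_boot all_order all_algebra.
From mathcomp Require Import zify ring lra realalg.
Set Implicit Arguments. Unset Strict Implicit. Unset Printing Implicit Defensive.
Import Order.TTheory GRing.Theory Num.Theory.

(** Both numbers [-2 +- sqrt 2] are distance eigenvalues of [K_s^t], with
    eigenvectors supported on two pendant vertices and their neighbours. For
    [K_n^{n_1,...,n_k}], an eigenvalue [mu] outside [{-1} \cup {-1 - n_i}]
    satisfies [mu = (1 + 2 mu) \sum_i n_i / (mu + 1 + n_i)]. Writing
    [h_i = (n_i - 1)^2 - 2], the equations for the two conjugate eigenvalues
    amount to [\sum_i (1 + 1 / h_i) = 3] and [\sum_i n_i / h_i = -1]. The terms
    [1 + 1 / h_i] are 1/2 for n_i = 1, 0 for n_i = 2, and exceed 1 otherwise, so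
    few cases remain, and the only solution is the multiset {2, 2, 3, 3}. Then
    n = 11, and the traces of the squared distance matrices differ: 332 for this
    graph, but 222, 284, 350 or 420 for [K_s^t]. *)

(** * Distances from shortest walks, and their values in the two graphs *)

Lemma gdistE (n : nat) (e : rel 'I_n) (x y : 'I_n) (d : nat) :
  d < n -> walkn e d x y -> (forall k, k < d -> ~~ walkn e k x y) ->
  gdist e x y = d.
Proof.
move=> dn wd wk; rewrite /gdist.
have nthE k : k < n -> nth 0 (iota 0 n) k = k by move=> kn; rewrite nth_iota.
have H : has (fun k => walkn e k x y) (iota 0 n).
  by apply/hasP; exists d; rewrite // mem_iota.
set p := (fun k => walkn e k x y) in H *.
have fn : find p (iota 0 n) < n by rewrite -[ltnRHS](size_iota 0) -has_find.
apply/eqP; rewrite eqn_leq; apply/andP; split.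
  rewrite leqNgt; apply/negP => /(before_find 0).
  by rewrite nthE // /p wd.
rewrite leqNgt; apply/negP => /wk /negP; apply.
by have := nth_find 0 H; rewrite nthE.
Qed.

Lemma walk1 (n : nat) (e : rel 'I_n) (x y : 'I_n) : walkn e 1 x y = e x y.
Proof.
by apply/existsP/idP => [[z /andP[? /eqP <-]]|?] //; exists y; rewrite eqxx andbT.
Qed.

Lemma walk2P (n : nat) (e : rel 'I_n) (x y : 'I_n) :
  reflect (exists2 z, e x z & e z y) (walkn e 2 x y).
Proof.
apply: (iffP existsP) => [[z /andP[exz]]|[z exz ezy]].
  by rewrite -/(walkn e 1 z y) walk1; exists z.
by exists z; rewrite exz -/(walkn e 1 z y) walk1.
Qed.

Lemma gdist_id (n : nat) (e : rel 'I_n) (x : 'I_n) : gdist e x x = 0.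
Proof. by apply: gdistE => //=; case: x => m; case: n e. Qed.

Lemma gdist1 (n : nat) (e : rel 'I_n) (x y : 'I_n) :
  x != y -> e x y -> gdist e x y = 1.
Proof.
move=> xy exy; apply: gdistE; last by case.
  by move: xy; rewrite -val_eqE /=; have := ltn_ord x; have := ltn_ord y; lia.
by rewrite walk1.
Qed.

Lemma gdist2 (n : nat) (e : rel 'I_n) (x y z : 'I_n) :
  2 < n -> x != y -> ~~ e x y -> e x z -> e z y -> gdist e x y = 2.
Proof.
move=> n2 xy nexy exz ezy; apply: gdistE => //; first by apply/walk2P; exists z.
by case=> [|[|]] // _; rewrite walk1.
Qed.

(** Stated on plain naturals so that matrix traces can later be evaluated by computation; [j - s] is
    the clique neighbour of a pendant vertex [j]. *)
Definition Kst_dist (s i j : nat) : nat :=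
  if i == j then 0 else
  if i < s then (if (j < s) || (i == j - s) then 1 else 2)
  else if j < s then (if j == i - s then 1 else 2) else 3.

Lemma Kst_gdist (s t : nat) (i j : 'I_(s + t)) : 2 <= t -> t <= s ->
  gdist (Kst_adj s t) i j = Kst_dist s i j.
Proof.
move=> t2 ts; rewrite /Kst_dist.
have [/val_inj -> | nij] := eqVneq (i : nat) (j : nat); first exact: gdist_id.
have nij' : i != j by [].
have adjE (x y : 'I_(s + t)) : Kst_adj s t x y = (x != y :> nat) &&
    [|| (x < s) && (y < s), (s <= x) && (y == x - s :> nat)
      | (s <= y) && (x == y - s :> nat)] by [].
have Hi := ltn_ord i; have Hj := ltn_ord j.
case: ltnP => si.
  case: ifP => hj; first by apply: gdist1 => //; rewrite adjE; move/orP: hj; lia.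
  have zP : j - s < s + t by lia.
  apply: (@gdist2 _ _ _ _ (Ordinal zP)) => //; rewrite ?adjE /=; move/negP/negP: hj; lia.
case: ltnP => sj.
  case: ifP => hj; first by apply: gdist1 => //; rewrite adjE; lia.
  have zP : i - s < s + t by lia.
  apply: (@gdist2 _ _ _ _ (Ordinal zP)) => //; rewrite ?adjE /=; lia.
have aP : i - s < s + t by lia.
have bP : j - s < s + t by lia.
apply: gdistE; first lia.
  apply/existsP; exists (Ordinal aP); rewrite adjE /=.
  apply/andP; split; first by lia.
  by apply/walk2P; exists (Ordinal bP); rewrite adjE /=; lia.
case=> [|[|[|k]]] // _; first by rewrite walk1 adjE; lia.
(* A walk of length 2 needs a common neighbour, but the only neighbours [i - s] and [j - s] of the
   two pendant vertices differ. *)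
by apply/negP => /walk2P [z]; rewrite !adjE; have := ltn_ord z; lia.
Qed.

Definition Kns_dist (ns : seq nat) (i j : nat) : nat :=
  if i == j then 0 else
  if [|| i == 0, j == 0 | block ns i == block ns j] then 1 else 2.

Lemma Kns_gdist (ns : seq nat) (i j : 'I_(sumn ns).+1) :
  gdist (Kns_adj ns) i j = Kns_dist ns i j.
Proof.
rewrite /Kns_dist.
have [/val_inj -> | nij] := eqVneq (i : nat) (j : nat); first exact: gdist_id.
have nij' : i != j by [].
have Hi := ltn_ord i; have Hj := ltn_ord j.
case: ifP => hb; first by apply: gdist1 => //; rewrite /Kns_adj nij'.
have /norP[i0 /norP[j0 _]] := negbT hb.
apply: (@gdist2 _ _ _ _ ord0) => //; first lia.
- by rewrite /Kns_adj hb andbF.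
- by rewrite /Kns_adj /= orbT andbT.
- by rewrite /Kns_adj /= andbT eq_sym.
Qed.

(** * Block indices and block sizes *)

Lemma block_cons (a : nat) (ns : seq nat) (v : nat) :
  block (a :: ns) v = if v <= a then 0 else (block ns (v - a)).+1.
Proof.
rewrite /block /= take0 /= addn0; case: ifP => // va; congr _.+1.
rewrite -[1]addn0 iotaDl find_map; apply: eq_find => b /=.
by rewrite leq_subLR.
Qed.

Lemma block_lt (ns : seq nat) (i : nat) :
  i < sumn ns -> block ns i.+1 < size ns.
Proof.
elim: ns i => [|a ns IH] i //= ia; rewrite block_cons; case: ifP => // ai.
by rewrite ltnS subSn; [apply: IH; lia | lia].
Qed.

Lemma card_block (ns : seq nat) (b : nat) :
  \sum_(i < sumn ns | block ns i.+1 == b) 1 = nth 0 ns b.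
Proof.
rewrite -(big_mkord (fun i => block ns i.+1 == b) (fun=> 1)).
elim: ns b => [|a ns IH] b; first by rewrite big_nil nth_nil.
(* The first [a] indices form block 0; shifted down by [a], the others lie in the blocks of the
   tail, numbered one lower. *)
rewrite (@big_cat_nat _ _ _ a) //=; last exact: leq_addr.
have shift (P : pred nat) N : \sum_(a <= i < a + N | P i) 1
    = \sum_(0 <= i < N | P (i + a)) 1.
  by rewrite -{1}[a]add0n big_addn addKn.
rewrite shift.
rewrite [X in X + _](_ : _ = (b == 0) * a); last first.
  rewrite big_nat_cond (eq_bigl (fun i => (0 <= i < a) && (b == 0))).
    rewrite -big_nat_cond; case: b => [|b]; last by rewrite big_pred0.
    by rewrite sum_nat_const_nat subn0 mul1n muln1.
  move=> i; case: (ltnP i a) => /= [ia|]; last by [].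
  by rewrite block_cons ia eq_sym.
rewrite [X in _ + X](_ : _ = \sum_(0 <= i < sumn ns | (block ns i.+1).+1 == b) 1).
  case: b => [|b] /=; last by rewrite add0n -IH.
  by rewrite mul1n big_pred0 ?addn0.
apply: eq_bigl => i; rewrite block_cons ifF; last by lia.
by congr (_.+1 == _); congr block; lia.
Qed.

(** * Linear algebra: traces of squares, and the eigenvalue equation for a partition into cliques *)

Section Spectrum.
Local Open Scope ring_scope.

(* [det (X^2 - A^2) = det (X - A) det (X + A)]. *)
Lemma char_poly_sqr (R : comNzRingType) (n : nat) (A : 'M[R]_n) :
  char_poly (A *m A) \Po 'X^2
    = (-1) ^+ n *: (char_poly A * (char_poly A \Po - 'X)).
Proof.
have neg : char_poly_mx A *m - map_mx (comp_poly (- 'X)) (char_poly_mx A) =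
    map_mx (comp_poly 'X^2) (char_poly_mx (A *m A)).
  have mapC (q : {poly R}) (B : 'M[R]_n) :
      map_mx (comp_poly q) (map_mx polyC B) = map_mx polyC B.
    by apply/matrixP => i j; rewrite !mxE comp_polyC.
  have mapX (q : {poly R}) : map_mx (comp_poly q) 'X%:M = q *: 1%:M :> 'M_n.
    by rewrite map_scalar_mx /= comp_polyX scalemx1.
  rewrite /char_poly_mx !map_mxB !mapC !mapX -[X in X - _]scalemx1 scaleNr opprB opprK.
  rewrite mulmxDr !mulmxBl -!scalemxAl -!scalemxAr !mul1mx !mulmx1 map_mxM scalerA -expr2.
  by rewrite addrC addrA subrK.
rewrite /char_poly -(det_map_mx (comp_poly 'X^2)) -neg det_mulmx.
rewrite -scaleN1r detZ (det_map_mx (comp_poly (- 'X))) -mul_polyC.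
by rewrite rmorphXn rmorphN rmorph1 mulrCA.
Qed.

Lemma comp_poly_X2_inj (R : comNzRingType) (p q : {poly R}) :
  p \Po 'X^2 = q \Po 'X^2 -> p = q.
Proof.
move=> pq; apply/polyP => i; have := congr1 (fun r : {poly R} => r`_(2 * i)) pq.
by rewrite !coef_comp_poly_Xn // dvdn_mulr // mulKn.
Qed.

(** By [char_poly_sqr], the characteristic polynomial of [A] determines that of [A *m A], whose
    subleading coefficient is minus the trace. *)
Lemma char_poly_trace_sqr (R : comNzRingType) (m n : nat) (A : 'M[R]_m) (B : 'M[R]_n) :
  char_poly A = char_poly B -> \tr (A *m A) = \tr (B *m B).
Proof.
move=> eqAB.
have : m.+1 = n.+1 by rewrite -(size_char_poly A) -(size_char_poly B) eqAB.
case=> eq_mn; case: n / eq_mn B eqAB => B eqAB.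
case: m A B eqAB => [|m] A B eqAB; first by rewrite /mxtrace !big_ord0.
have eq2 : char_poly (A *m A) = char_poly (B *m B).
  by apply: comp_poly_X2_inj; rewrite !char_poly_sqr eqAB.
have trA := char_poly_trace (A *m A) isT; have trB := char_poly_trace (B *m B) isT.
by apply: oppr_inj; rewrite -[LHS]trA -[RHS]trB eq2.
Qed.

(** Here [v0] is the eigenvector entry at the dominating vertex, [v] holds the others and [c] is the
    block map. With [w = v0 + 2 * S], summing the row equations over block [b] gives
    [T b = w * N b / (mu + 1 + N b)]; summing over [b] and using [S = mu * v0] leaves a multiple of
    [v0] on both sides. *)
Lemma class_secular (F : fieldType) (I J : finType) (c : I -> J) (mu v0 : F)
    (v : I -> F) (N : J -> nat) :
  (forall b, N b = \sum_(i | c i == b) 1)%N ->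
  mu + 1 != 0 -> (forall b, mu + 1 + (N b)%:R != 0) ->
  v0 != 0 \/ (exists i, v i != 0) ->
  \sum_i v i = mu * v0 ->
  (forall i, v0 + 2 * \sum_j v j - \sum_(j | c j == c i) v j - v i = mu * v i) ->
  mu = (1 + 2 * mu) * \sum_b (N b)%:R / (mu + 1 + (N b)%:R).
Proof.
move=> NE mu1 muN nz eq0 eqv.
set S := \sum_i v i in eq0 eqv.
pose T b := \sum_(j | c j == b) v j.
have vE i : v i = (v0 + 2 * S - T (c i)) / (mu + 1).
  apply: (mulIf mu1); rewrite divfK // mulrDr mulr1 [_ * mu]mulrC -(eqv i) -/(T _).
  by ring.
have TE b : T b = (v0 + 2 * S) * ((N b)%:R / (mu + 1 + (N b)%:R)).
  have : (mu + 1) * T b = (N b)%:R * (v0 + 2 * S - T b).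
    rewrite {1}/T mulr_sumr NE natr_sum mulr_suml; apply: eq_bigr => i /eqP <-.
    by rewrite mul1r [in LHS]vE mulrC divfK.
  move=> H; apply: (mulIf (muN b)); rewrite -mulrA divfK //.
  by rewrite mulrDr [T b * _]mulrC H; ring.
have SE : S = (v0 + 2 * S) * \sum_b (N b)%:R / (mu + 1 + (N b)%:R).
  rewrite {1}/S (partition_big c xpredT) //= mulr_sumr.
  by apply: eq_bigr => b _; rewrite -TE.
(* If [v0 = 0], then [S] and [v0 + 2 * S] vanish, hence all [T b] and all [v i], contradicting
   [nz]. *)
have nz0 : v0 != 0.
  apply/eqP => v00; have S0 : S = 0 by rewrite eq0 v00 mulr0.
  have w0 : v0 + 2 * S = 0 by rewrite v00 S0; ring.
  case: nz => [|[i]]; first by rewrite v00 eqxx.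
  by rewrite vE TE w0 mul0r subr0 mul0r eqxx.
by apply: (mulIf nz0); rewrite -eq0 {1}SE eq0; ring.
Qed.

(* The norm of [n - 1 + sqrt 2] in Z[sqrt 2]. *)
Definition norm_sqrt2 (R : pzRingType) (n : nat) : R := (n%:R - 1) ^+ 2 - 2.

(** 2 is not the square of an integer. *)
Lemma norm_sqrt2_neq0 (R : numDomainType) (n : nat) : norm_sqrt2 R n != 0.
Proof.
case: n => [|n].
  by rewrite /norm_sqrt2 (_ : _ - 2 = -1) ?oppr_eq0 ?oner_eq0 //; ring.
rewrite /norm_sqrt2 -natr1 addrK subr_eq0 -natrX eqr_nat -mulnn.
by case: n => [|[|n]] //; rewrite mulnS; lia.
Qed.

(** * Solving the two equations for the clique sizes *)

Lemma sum_small_large (R : comPzRingType) (f : nat -> R)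
    (ns : seq nat) : all (fun m => 0 < m)%N ns ->
  \sum_(n <- ns) f n = (count_mem 1%N ns)%:R * f 1%N + (count_mem 2%N ns)%:R * f 2%N
    + \sum_(n <- [seq n <- ns | 3 <= n]%N) f n.
Proof.
elim: ns => [|a ns IH] /=; first by rewrite !big_nil => _; ring.
move=> /andP[a0 /IH {}IH]; rewrite big_cons IH.
case: a a0 => [|[|[|a]]] //= _; rewrite ?natrD ?big_cons /=; ring.
Qed.

Lemma norm_sqrt2_large (R : realFieldType) (n : nat) :
  (4 <= n)%N -> 0 < (norm_sqrt2 R n)^-1 <= 7^-1.
Proof.
move=> n4; have n4R : (4 : R) <= n%:R by rewrite (ler_nat R 4 n).
have h7 : 7 <= norm_sqrt2 R n.
  have : (3 : R) * 3 <= (n%:R - 1) * (n%:R - 1) by apply: ler_pM; lra.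
  by rewrite /norm_sqrt2 expr2; lra.
by apply/andP; split; rewrite ?invr_gt0 ?lef_pV2 ?posrE; lra.
Qed.

Lemma solve_secular (R : realFieldType) (ns : seq nat) : all (fun m => 0 < m)%N ns ->
  \sum_(n <- ns) (1 + (norm_sqrt2 R n)^-1) = 3 ->
  \sum_(n <- ns) n%:R * (norm_sqrt2 R n)^-1 = -1 ->
  perm_eq ns [:: 2; 2; 3; 3]%N.
Proof.
move=> pos; rewrite sum_small_large // => e1; rewrite sum_small_large // => e2.
move: e1 e2.
have h1 : (norm_sqrt2 R 1)^-1 = - 2^-1.
  by rewrite /norm_sqrt2 subrr expr0n /= sub0r invrN.
have h2 : (norm_sqrt2 R 2)^-1 = -1.
  by rewrite /norm_sqrt2 (_ : _ - 2 = -1) ?invrN1 //; ring.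
have h3 : (norm_sqrt2 R 3)^-1 = 2^-1 by rewrite /norm_sqrt2; congr _^-1; ring.
rewrite h1 h2.
set c1 := count_mem 1%N ns; set c2 := count_mem 2%N ns.
have c1_0 : (0 : R) <= c1%:R by [].
have pE : perm_eq ns (nseq c1 1%N ++ nseq c2 2%N ++ [seq n <- ns | 3 <= n]%N).
  rewrite /c1 /c2; elim: {c1 c2 c1_0} ns pos => //= a l IH /andP[a0 /IH {}IH].
  case: a a0 => [|[|[|a]]] //= _; rewrite ?perm_cons //.
    rewrite perm_sym -cat1s perm_catCA /= perm_cons perm_sym //.
  rewrite perm_sym -cat1s catA perm_catCA /= perm_cons perm_sym -catA //.
have large n : n \in [seq n <- ns | 3 <= n]%N ->
    n = 3%N \/ (3 < n)%N by rewrite mem_filter; lia.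
have nat_small (c : nat) (k : nat) : c%:R < k%:R :> R -> (c < k)%N by rewrite ltr_nat.
case: [seq n <- ns | 3 <= n]%N pE large => [|x [|y [|z r]]] pE large;
  rewrite ?big_cons ?big_nil => e1 e2.
(* No size above 2: the second equation would give [c2 = -1]. *)
- have c6 : c1%:R = 6 :> R by lra.
  have c20 : (0 : R) <= c2%:R by [].
  lra.
(* One size above 2. If it exceeds 3, then [c1] lies in the interval from [4 - 2/7] to 4, with 4
   excluded, which contains no integer. If it is 3, then [2 * c2 = 1]. *)
- have [x3|/(norm_sqrt2_large R)/andP[a b]] := large x (mem_head _ _); last first.
    have /nat_small : c1%:R < 4%:R :> R by lra.
    case: c1 e1 {e2 pE c1_0} => [|[|[|[|]]]] // e1 _; lra.
  rewrite x3 h3 in e1 e2.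
  have c3 : c1%:R = 3 :> R by lra.
  have /eqP : (2 * c2)%:R = 1%:R :> R by rewrite natrM; lra.
  by rewrite eqr_nat; lia.
(* Two sizes above 2. If one or both exceed 3, then [c1] falls strictly between consecutive
   integers; if both are 3, then [c1 = 0] and [c2 = 2]. *)
- have xl := large x (mem_head _ _).
  have yl : y = 3%N \/ (3 < y)%N by apply: large; rewrite !inE eqxx orbT.
  have c1lt : (c1 < 2)%N.
    apply: nat_small; case: xl => [x3|/(norm_sqrt2_large R)/andP[a b]];
      case: yl => [y3|/(norm_sqrt2_large R)/andP[a' b']]; subst; rewrite ?h3 in e1; lra.
  case: xl => [x3|/(norm_sqrt2_large R)/andP[a b]]; last first.
    case: yl => [y3|/(norm_sqrt2_large R)/andP[a' b']]; subst; rewrite ?h3 in e1;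
    case: c1 e1 c1lt {e2 pE c1_0} => [|[|]] // e1 _; lra.
  case: yl => [y3|/(norm_sqrt2_large R)/andP[a b]]; last first.
    subst; rewrite ?h3 in e1;
    case: c1 e1 c1lt {e2 pE c1_0} => [|[|]] // e1 _; lra.
  subst; rewrite h3 in e1 e2.
  have : c1%:R = 0%:R :> R by lra.
  have : c2%:R = 2%:R :> R by lra.
  by move=> /eqP; rewrite eqr_nat => /eqP c2E /eqP; rewrite eqr_nat => /eqP c1E;
    move: pE; rewrite c1E c2E.
(* Three or more sizes above 2: each contributes more than 1 to the first sum, which then exceeds
   3. *)
- have pos_inv n : n = 3%N \/ (3 < n)%N -> 0 < (norm_sqrt2 R n)^-1.
    by case=> [->|/(norm_sqrt2_large R)/andP[]//]; rewrite h3; lra.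
  have hx := pos_inv x (large x (mem_head _ _)).
  have hy : 0 < (norm_sqrt2 R y)^-1 by apply/pos_inv/large; rewrite !inE eqxx !orbT.
  have hz : 0 < (norm_sqrt2 R z)^-1 by apply/pos_inv/large; rewrite !inE eqxx !orbT.
  have hr : 0 <= \sum_(j <- r) (1 + (norm_sqrt2 R j)^-1).
    rewrite big_seq; apply: sumr_ge0 => j jr.
    have : 0 < (norm_sqrt2 R j)^-1 by apply/pos_inv/large; rewrite !inE jr !orbT.
    lra.
  lra.
Qed.

(** * Distance eigenvalues of the two graphs *)

Lemma root_char_polyP (F : fieldType) (n : nat) (A : 'M[int]_n) (mu : F) :
  reflect (exists2 v : 'rV[F]_n, v != 0 &
             forall j, \sum_i v 0 i * (A i j)%:~R = mu * v 0 j)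
          (root (map_poly intr (char_poly A)) mu).
Proof.
rewrite map_char_poly -eigenvalue_root_char.
apply: (iffP eigenvalueP) => [[v vA nz]|[v nz vA]]; exists v => //.
  move=> j; move/rowP: vA => /(_ j); rewrite !mxE => <-.
  by apply: eq_bigr => i _; rewrite mxE.
apply/rowP => j; rewrite !mxE -vA.
by apply: eq_bigr => i _; rewrite mxE.
Qed.

Lemma Kst_root (R : fieldType) (s t : nat) (c : R) : (2 <= t)%N -> (t <= s)%N ->
  c ^+ 2 = 2 -> root (map_poly intr (char_poly (distmx (Kst_adj s t)))) (c - 2).
Proof.
move=> t2 ts c2; apply/root_char_polyP.
(* On vectors with entries [x, -x, y, -y] at [0, 1, s, s.+1] and zero elsewhere, the distance matrix
   sends [x] to [-x - y] and [y] to [-x - 3y]. Taking [x = 1] and eigenvalue [c - 2] forces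
   [y = 1 - c]. *)
pose f (i : nat) : R := if i == 0%N then 1 else if i == 1%N then -1 else
  if i == s then 1 - c else if i == s.+1 then c - 1 else 0.
have p0 : (0 < s + t)%N by lia.
have p1 : (1 < s + t)%N by lia.
have p2 : (s < s + t)%N by lia.
have p3 : (s.+1 < s + t)%N by lia.
exists (\row_i f i).
  by apply/eqP => /rowP/(_ (Ordinal p0)); rewrite !mxE /f /= => /eqP; rewrite oner_eq0.
move=> j; rewrite !mxE.
rewrite (bigD1 (Ordinal p0)) //= (bigD1 (Ordinal p1)) //=.
rewrite (bigD1 (Ordinal p2)) /=; last by rewrite -!val_eqE /=; lia.
rewrite (bigD1 (Ordinal p3)) /=; last by rewrite -!val_eqE /=; lia.
rewrite big1 => [|i]; last first.
  rewrite -!val_eqE /= mxE /f => /andP[/andP[/andP[/negPf-> /negPf->] /negPf->] /negPf->].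
  by rewrite mul0r.
have Hj := ltn_ord j.
rewrite !mxE !Kst_gdist //.
have fs : f s = 1 - c by rewrite /f eqxx /= ifF 1?ifF //; lia.
have fs1 : f s.+1 = c - 1 by rewrite /f eqxx /= ifF 1?ifF //; lia.
have f0 : f (Ordinal p0) = 1 by [].
have f1 : f (Ordinal p1) = -1 by [].
rewrite f0 f1 fs fs1.
have cases : [\/ j = 0 :> nat, j = 1 :> nat, j = s :> nat | j = s.+1 :> nat]%N
    \/ ((1 < j < s) || (s.+1 < j))%N.
  case: (eqVneq (j : nat) 0%N) => ?; first by left; constructor 1.
  case: (eqVneq (j : nat) 1%N) => ?; first by left; constructor 2.
  case: (eqVneq (j : nat) s) => ?; first by left; constructor 3.
  case: (eqVneq (j : nat) s.+1) => ?; first by left; constructor 4.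
  by right; lia.
pose d0 := Kst_dist s 0 j; pose d1 := Kst_dist s 1 j.
pose ds := Kst_dist s s j; pose ds1 := Kst_dist s s.+1 j.
have cc : c * c = 2 by rewrite -expr2.
rewrite -/d0 -/d1 -/ds -/ds1.
case: cases => [[] jE|jE].
- have [-> -> -> ->] : [/\ d0 = 0, d1 = 1, ds = 1 & ds1 = 2]%N.
    by rewrite /d0 /d1 /ds /ds1 /Kst_dist; split; repeat case: ifP; lia.
  by rewrite jE /f /=; ring: cc.
- have [-> -> -> ->] : [/\ d0 = 1, d1 = 0, ds = 2 & ds1 = 1]%N.
    by rewrite /d0 /d1 /ds /ds1 /Kst_dist; split; repeat case: ifP; lia.
  by rewrite jE /f /=; ring: cc.
- have [-> -> -> ->] : [/\ d0 = 1, d1 = 2, ds = 0 & ds1 = 3]%N.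
    by rewrite /d0 /d1 /ds /ds1 /Kst_dist; split; repeat case: ifP; lia.
  by rewrite jE fs; ring: cc.
- have [-> -> -> ->] : [/\ d0 = 2, d1 = 1, ds = 3 & ds1 = 0]%N.
    by rewrite /d0 /d1 /ds /ds1 /Kst_dist; split; repeat case: ifP; lia.
  by rewrite jE fs1; ring: cc.
(* Off the support, [j] is equidistant from 0 and 1, and from [s] and [s.+1], so the contributions
   cancel. *)
have -> : d0 = d1 by rewrite /d0 /d1 /Kst_dist; repeat case: ifP; lia.
have -> : ds = ds1 by rewrite /ds /ds1 /Kst_dist; repeat case: ifP; lia.
by rewrite /f !ifF; [ring | lia..].
Qed.

Lemma Kns_secular (R : fieldType) (ns : seq nat) (mu : R) :
  mu + 1 != 0 -> (forall n : nat, mu + 1 + n%:R != 0) ->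
  root (map_poly intr (char_poly (distmx (Kns_adj ns)))) mu ->
  mu = (1 + 2 * mu) * \sum_(n <- ns) n%:R / (mu + 1 + n%:R).
Proof.
move=> mu1 mun /root_char_polyP [v nz vD].
rewrite (big_nth 0%N) big_mkord.
pose c (i : 'I_(sumn ns)) := Ordinal (block_lt (ltn_ord i)).
have cE (i j : 'I_(sumn ns)) : (c i == c j) = (block ns i.+1 == block ns j.+1) by [].
apply: (@class_secular _ _ _ c mu (v 0 ord0) (fun i => v 0 (lift ord0 i))) => //.
- by move=> b; rewrite -card_block.
- have [v0|v0] := eqVneq (v 0 ord0) 0; [right | by left].
  apply/existsP; apply: contraNT nz => nv.
  apply/eqP/rowP => i; rewrite mxE; case: (unliftP ord0 i) => [j ->|-> //].
  by apply/eqP; apply: contraNT nv => ?; apply/existsP; exists j.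
- rewrite -(vD ord0) big_ord_recl mxE Kns_gdist /= mulr0 add0r.
  by apply: eq_bigr => i _; rewrite mxE Kns_gdist mulr1.
move=> i; rewrite -(vD (lift ord0 i)) big_ord_recl mxE Kns_gdist /= mulr1.
rewrite -!addrA; congr (_ + _).
(* All sums are put over the same range, so the weights can be compared termwise: 2, minus 1 inside
   the block of [i], minus 1 more at [i] itself. *)
rewrite addrA mulr_sumr (big_mkcond (fun j => c j == c i)) -sumrB.
rewrite -[X in _ - X](@big_pred1_eq _ 0 +%R _ i (fun j => v 0 (lift ord0 j))).
rewrite (big_mkcond (fun j => j == i)) -sumrB; apply: eq_bigr => j _.
rewrite mxE Kns_gdist /Kns_dist cE !lift0 eqSS (inj_eq val_inj) /=.
case: (eqVneq j i) => [->|_]; first by rewrite eqxx; ring.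
by case: ifP => _; ring.
Qed.

(** Multiplying numerator and denominator by [n - 1 - c] turns the equation into
    [c - 2 = (2c - 3)(P - cQ)]. Comparing [c] with [-c] separates the part free of [c] ([e3]) from
    the coefficient of [c] ([e4]), giving [P = 2] and [Q = -1]. *)
Lemma secular_pair (R : realFieldType) (ns : seq nat) (c : R) : c ^+ 2 = 2 -> c != 0 ->
  (forall c' : R, c' ^+ 2 = 2 ->
     c' - 2 = (1 + 2 * (c' - 2)) * \sum_(n <- ns) n%:R / (c' - 2 + 1 + n%:R)) ->
  \sum_(n <- ns) (1 + (norm_sqrt2 R n)^-1) = 3 /\
  \sum_(n <- ns) n%:R * (norm_sqrt2 R n)^-1 = -1.
Proof.
move=> c2 c0 H.
set Q := \sum_(n <- ns) n%:R * _.
pose P := \sum_(n <- ns) n%:R * (n%:R - 1) * (norm_sqrt2 R n)^-1.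
have E (c' : R) : c' ^+ 2 = 2 -> \sum_(n <- ns) n%:R / (c' - 2 + 1 + n%:R) = P - c' * Q.
  move=> c'2; rewrite /P /Q mulr_sumr -sumrB; apply: eq_bigr => n _.
  have hE : norm_sqrt2 R n = (c' - 2 + 1 + n%:R) * (n%:R - 1 - c').
    by rewrite /norm_sqrt2; ring: c'2.
  have := norm_sqrt2_neq0 R n; rewrite hE mulf_eq0 negb_or => /andP[? ?].
  by field; apply/andP.
have e1 := H c c2; rewrite E // in e1.
have c2' : (- c) ^+ 2 = 2 by rewrite sqrrN.
have e2 := H _ c2'; rewrite E // in e2.
have cc : c * c = 2 by rewrite -expr2.
have e3 : 3 * P + 4 * Q = 2.
  have -> : 3 * P + 4 * Q = 3 * P + 2 * (c * c) * Q by rewrite cc; ring.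
  lra.
have e4 : 2 * P + 3 * Q = 1.
  by apply: (mulfI c0); lra.
(* The numerator [n(n - 1) - n] equals [norm_sqrt2 R n + 1]. *)
have PQ : P - Q = \sum_(n <- ns) (1 + (norm_sqrt2 R n)^-1).
  rewrite /P /Q -sumrB; apply: eq_bigr => n _.
  by have := norm_sqrt2_neq0 R n; rewrite /norm_sqrt2 => ?; field.
by rewrite -PQ; split; lra.
Qed.

(** * Comparison of traces and conclusion *)

Lemma sumn_map_iota (f : nat -> nat) (n : nat) :
  sumn [seq f i | i <- iota 0 n] = (\sum_(i < n) f i)%N.
Proof. by rewrite sumnE big_map -(big_mkord xpredT f) /index_iota subn0. Qed.

Lemma tr_distmx_sqr (n : nat) (e : rel 'I_n) (d : nat -> nat -> nat) :
  (forall i j : 'I_n, gdist e i j = d i j) ->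
  \tr (distmx e *m distmx e)
    = sumn [seq sumn [seq (d i j * d j i)%N | j <- iota 0 n] | i <- iota 0 n] :> int.
Proof.
move=> dE; rewrite sumn_map_iota -natz natr_sum; apply: eq_bigr => i _.
rewrite mxE sumn_map_iota natr_sum; apply: eq_bigr => j _.
by rewrite !mxE !dE natz.
Qed.

Lemma D_cospectral_sizes (s t : nat) (ns : seq nat) :
  (2 <= t)%N -> (t <= s)%N -> all (fun m => 0 < m)%N ns ->
  D_cospectral (Kst_adj s t) (Kns_adj ns) -> perm_eq ns [:: 2; 2; 3; 3]%N.
Proof.
move=> t2 ts pos cosp.
(* An ordered field containing the square root of 2 is required: the eigenvalues live there, and the
   sizes are found by inequalities. *)
pose c : realalg := Num.sqrt 2.
have c2 : c ^+ 2 = 2 by rewrite sqr_sqrtr.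
have c0 : c != 0 by rewrite sqrtr_eq0 -ltNge.
have sec (c' : realalg) : c' ^+ 2 = 2 ->
    c' - 2 = (1 + 2 * (c' - 2)) * \sum_(n <- ns) n%:R / (c' - 2 + 1 + n%:R).
  move=> c'2.
  have nz (n : nat) : c' - 2 + 1 + n%:R != 0.
    apply: contraNneq (norm_sqrt2_neq0 realalg n) => h0.
    have -> : norm_sqrt2 realalg n = (c' - 2 + 1 + n%:R) * (n%:R - 1 - c').
      by rewrite /norm_sqrt2; ring: c'2.
    by rewrite h0 mul0r.
  apply: Kns_secular => //; first by have := nz 0%N; rewrite addr0.
  by rewrite -[char_poly _]cosp; apply: Kst_root.
have [e1 e2] := secular_pair c2 c0 sec.
exact: solve_secular pos e1 e2.
Qed.

End Spectrum.

Theorem theorem3p6 (s t : nat) (ns : seq nat) :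
  2 <= t -> t <= s -> 2 <= size ns -> all (fun m => 0 < m) ns ->
  (sumn ns).+1 = s + t ->
  ~ D_cospectral (Kst_adj s t) (Kns_adj ns).
Proof.
move=> t2 ts _ pos sumE cosp.
have nsE := D_cospectral_sizes t2 ts pos cosp.
have := char_poly_trace_sqr cosp.
rewrite (tr_distmx_sqr (fun i j => Kst_gdist i j t2 ts)).
rewrite (tr_distmx_sqr (@Kns_gdist ns)).
have sum11 : s + t = 11 by rewrite -sumE (perm_sumn nsE).
rewrite -mem_permutations in nsE; rewrite sumE sum11.
(* The sizes are known only up to order while [block] depends on the order, so every arrangement is
   evaluated. *)
have /allP/(_ _ nsE)/eqP -> : all (fun l =>
    sumn [seq sumn [seq Kns_dist l i j * Kns_dist l j i | j <- iota 0 11]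
         | i <- iota 0 11] == 332) (permutations [:: 2; 2; 3; 3]).
  by vm_compute.
(* From [s + t = 11] and [2 <= t <= s]; none of these four values gives trace 332. *)
have : s \in [:: 6; 7; 8; 9] by rewrite !inE; lia.
by rewrite !inE => /or4P[] /eqP ->; vm_compute.
Qed.
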